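(* Fix an integer $L_2\ge 1$. Then for every integer $L_1$ with $1\le L_1\le L_2$, $$J_{L_2}(r)=J_{L_1}(r)+O\!\left(r^{L_1+2}\right)\qquad\text{as } r\to 0^+,$$ where $J_L(r)$ denotes the stationary current of the open totally asymmetric simple exclusion process on $2L$ sites with entry and exit rates equal to $1$ and with a blockage of rate $r$ at the central bond.
   Context: Open totally asymmetric simple exclusion process with a blockage: for an integer $L\ge1$ and a rate $r>0$, consider the continuous-time Markov chain on configurations $\eta=(\eta(-L+1),\eta(-L+2),\dots,\eta(L))\in\{0,1\}^{2L}$, where $\eta(k)=1$ means site $k$ is occupied by a particle and $\eta(k)=0$ means it is empty. The transitions are: (i) if $\eta(-L+1)=0$, a particle is added at site $-L+1$ at rate $1$; (ii) for each $i\in\{-L+1,\dots,L-1\}$ with $i\neq 0$, if $\eta(i)=1$ and $\eta(i+1)=0$, the particle at $i$ jumps to $i+1$ at rate $1$; (iii) if $\eta(0)=1$ and $\eta(1)=0$, the particle at $0$ jumps to $1$ at rate $r$; (iv) if $\eta(L)=1$, the particle at site $L$ is removed at rate $1$. No other transitions occur. This chain has a unique stationary distribution; $J_L(r)$ is the stationary current, i.e. $J_L(r)=r\,\Pr(\eta(0)=1,\ \eta(1)=0)$ in the stationary distribution (equivalently, the stationary expected rate of particle passage across any bond, or of entry or exit of particles). The implied constant in $O(\cdot)$ may depend on $L_1$ and $L_2$. *)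

(* Defs.v *)
From mathcomp Require Import all_boot all_order all_algebra.
From mathcomp Require Import boolp classical_sets reals topology normedtype landau.

Set Implicit Arguments.
Unset Strict Implicit.
Unset Printing Implicit Defensive.

Import Order.TTheory GRing.Theory Num.Theory.
Import numFieldNormedType.Exports.

Local Open Scope ring_scope.

Definition config (L : nat) := {ffun 'I_(2 * L) -> bool}.

(* The sites are numbered -L+1, ..., L: index i of the finite function stands
   for site i - L + 1, so the central bond joins sites 0 and 1. *)
Definition site (L : nat) (i : 'I_(2 * L)) : int := i%:Z - L%:Z + 1.

(* Only ever evaluated at k in {-L+1, ..., L}; false outside that range. *)
Definition occupied (L : nat) (eta : config L) (k : int) : bool :=
  [exists i, (site i == k) && eta i].

Definition update (L : nat) (eta : config L) (k : int) (b : bool) : config L :=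
  [ffun i => if site i == k then b else eta i].

Section Dynamics.
Variables (R : realType) (L : nat) (r : R).
Implicit Types eta xi : config L.

Definition entry_rate eta xi : R :=
  let k := - L%:Z + 1 in
  if ~~ occupied eta k && (xi == update eta k true) then 1 else 0.

Definition exit_rate eta xi : R :=
  if occupied eta L%:Z && (xi == update eta L%:Z false) then 1 else 0.

Definition jump_rate (k : int) eta xi : R :=
  if [&& occupied eta k, ~~ occupied eta (k + 1) &
         xi == update (update eta k false) (k + 1) true]
  then (if k == 0 then r else 1) else 0.

(* For L >= 1 every move changes the configuration, so the diagonal vanishes. *)
Definition rate eta xi : R :=
  entry_rate eta xi
  + \sum_(i : 'I_(2 * L) | site i < L%:Z) jump_rate (site i) eta xi
  + exit_rate eta xi.

Definition generator eta xi : R :=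
  rate eta xi - (if xi == eta then \sum_zeta rate eta zeta else 0).

Definition stationary (p : {ffun config L -> R}) : Prop :=
  [/\ forall eta, 0 <= p eta,
      \sum_eta p eta = 1 &
      forall xi, \sum_eta p eta * generator eta xi = 0].

(* For L >= 1 and r > 0 there is exactly one such p; the default value 0 is
   irrelevant. *)
Definition stationary_distribution : {ffun config L -> R} :=
  xget 0 [set p | stationary p]%classic.

Definition current : R :=
  r * \sum_(eta | occupied eta 0 && ~~ occupied eta 1)
        stationary_distribution eta.

End Dynamics.

(* Main.v *)
Require Import Defs.
From mathcomp Require Import all_boot all_order all_algebra zify ring lra.
From mathcomp Require Import boolp classical_sets functions reals topology normedtype landau.

Set Implicit Arguments.
Unset Strict Implicit.
Unset Printing Implicit Defensive.

Import Order.TTheory GRing.Theory Num.Theory.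
Import numFieldNormedType.Exports.

Local Open Scope classical_set_scope.
Local Open Scope ring_scope.

(** Call holes on the left of the blockage and particles on its right defects.
    Without the blocked jump every defect travels outwards and leaves, and the
    step configuration is absorbing; each blocked jump creates one defect on
    either side.  Run the systems of sizes L1 <= L2 with the same clocks.  They
    can disagree about the sites next to the blockage only after an exit of the
    smaller system has been felt there, which takes a queue of L1 + 1 defects on
    one side.  In the coupled stationary state let Y_n be the set of pairs that
    look as if produced by at most n blocked jumps (in the sense of [compatible]).
    Testing stationarity against a potential restricted to the complement of Y_n
    shows that each further n costs a factor O(r), so the complement of Y_L1 has
    probability O(r^(L1+1)); the current carries one more factor r. *)

(** * Finite chains driven by clocks *)

(* At rate [c e] the clock [e] rings and the state [s] becomes [T e s]. *)
Section ClockChain.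
Variables (R : realFieldType) (S E : finType) (c : E -> R) (T : E -> S -> S).

Definition drift (phi : S -> R) (s : S) : R :=
  \sum_e c e * (phi (T e s) - phi s).

Definition invariant (p : S -> R) : Prop :=
  forall phi, \sum_s p s * drift phi s = 0.

Definition weight (s t : S) : R := \sum_e c e * (T e s == t)%:R.

Lemma sum_weight s (phi : S -> R) :
  \sum_t weight s t * phi t = \sum_e c e * phi (T e s).
Proof.
under eq_bigr do rewrite mulr_suml.
rewrite exchange_big; apply: eq_bigr => e _.
rewrite (bigD1 (T e s)) //= eqxx mulr1 big1 ?addr0 // => t /negPf tN.
by rewrite eq_sym tN mulr0 mul0r.
Qed.

Lemma drift_weight phi s :
  drift phi s = \sum_t weight s t * phi t - (\sum_e c e) * phi s.
Proof.
rewrite sum_weight mulr_suml -sumrB; apply: eq_bigr => e _.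
by rewrite mulrBr.
Qed.

Lemma sum_delta (p : S -> R) t : \sum_s p s * (s == t)%:R = p t.
Proof.
rewrite (bigD1 t) //= eqxx mulr1 big1 ?addr0 // => s /negPf ->.
by rewrite mulr0.
Qed.

(** These are the balance equations: they come from testing with indicator functions, which span all
    test functions. *)
Lemma invariantP (p : S -> R) :
  invariant p <-> forall t, \sum_s p s * weight s t = (\sum_e c e) * p t.
Proof.
split=> [pI t | pW phi].
  have := pI (fun s => (s == t)%:R).
  under eq_bigr do rewrite drift_weight sum_delta mulrBr mulrCA.
  by rewrite sumrB -mulr_sumr sum_delta => /eqP; rewrite subr_eq0 => /eqP.
under eq_bigr do rewrite drift_weight mulrBr mulr_sumr.
rewrite sumrB exchange_big -sumrB big1 // => t _.
under eq_bigr do rewrite mulrA.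
by rewrite -mulr_suml pW mulrCA mulrA subrr.
Qed.

Lemma invariantD (p q : S -> R) (a b : R) :
  invariant p -> invariant q -> invariant (fun s => a * p s + b * q s).
Proof.
move=> pI qI phi.
under eq_bigr do rewrite mulrDl -!mulrA.
by rewrite big_split /= -!mulr_sumr pI qI !mulr0 addr0.
Qed.

Hypothesis c_ge0 : forall e, 0 <= c e.

Lemma weight_ge0 s t : 0 <= weight s t.
Proof. by apply: sumr_ge0 => e _; rewrite mulr_ge0 // ler0n. Qed.

(** By the triangle inequality, C |p t| is at most the inflow of |p| into [t], where C is the total
    clock rate. Each row of [weight] sums to C, so both sides have the same sum over [t], and
    equality holds at every [t]. *)
Lemma invariant_norm (p : S -> R) : invariant p -> invariant (fun s => `|p s|).
Proof.
move=> /invariantP pW; apply/invariantP.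
set C := \sum_e c e in pW *.
have C_ge0 : 0 <= C by apply: sumr_ge0.
pose g t := \sum_s `|p s| * weight s t - C * `|p t|.
have g_ge0 t : 0 <= g t.
  rewrite subr_ge0 -(ger0_norm C_ge0) -normrM -pW.
  apply: le_trans (ler_norm_sum _ _ _) _.
  by apply: ler_sum => s _; rewrite normrM (ger0_norm (weight_ge0 _ _)).
have g0 : \sum_t g t = 0.
  rewrite sumrB exchange_big -sumrB big1 // => s _.
  rewrite -mulr_sumr.
  under eq_bigr do rewrite -[weight _ _]mulr1.
  rewrite (sum_weight s (fun=> 1)).
  under eq_bigr do rewrite mulr1.
  by rewrite mulrC subrr.
move=> t; apply/eqP; rewrite -subr_eq0; apply/eqP.
by apply: (psumr_eq0P _ g0).
Qed.

(** The matrix of the generator has zero row sums, hence is singular. A nonzero vector of its left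
    kernel, after taking absolute values and normalising, is an invariant distribution. *)
Lemma invariant_exists (s0 : S) :
  exists p : S -> R, [/\ forall s, 0 <= p s, \sum_s p s = 1 & invariant p].
Proof.
have sumE (F : S -> R) : \sum_(i < #|S|) F (enum_val i) = \sum_s F s.
  by rewrite [RHS](reindex _ (onW_bij _ (enum_val_bij S))).
pose C := \sum_e c e.
pose A : 'M[R]_#|S| := \matrix_(i, j)
  (weight (enum_val i) (enum_val j) - C * (enum_val i == enum_val j)%:R).
have detA : \det A = 0.
  rewrite -det_tr; apply/eqP/det0P; exists (const_mx 1).
    apply/eqP => /rowP/(_ (enum_rank s0)); rewrite !mxE => /eqP.
    by rewrite oner_eq0.
  apply/rowP => i; rewrite !mxE; set s := enum_val i.
  under eq_bigr do rewrite !mxE mul1r -/s.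
  rewrite (sumE (fun t => weight s t - C * (s == t)%:R)) /=.
  rewrite sumrB.
  under eq_bigr do rewrite -[weight _ _]mulr1.
  under [X in _ - X]eq_bigr do rewrite eq_sym.
  rewrite (sum_weight s (fun=> 1)) (sum_delta (fun=> C)).
  under eq_bigr do rewrite mulr1.
  by rewrite subrr.
have [v vN0 vA] : exists2 v : 'rV_#|S|, v != 0 & v *m A = 0.
  by apply/det0P; rewrite detA.
pose q s := v 0 (enum_rank s).
have qI : invariant q.
  apply/invariantP => t.
  have := congr1 (fun w : 'rV_#|S| => w 0 (enum_rank t)) vA; rewrite !mxE.
  under eq_bigr do rewrite !mxE enum_rankK mulrBr.
  under eq_bigr => i _ do rewrite -{1 3}[i]enum_valK.
  rewrite (sumE (fun s => q s * weight s t -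
     q s * (C * (s == t)%:R))) /=.
  under eq_bigr do rewrite [q _ * (C * _)]mulrCA.
  by rewrite sumrB -mulr_sumr sum_delta => /eqP; rewrite subr_eq0 => /eqP.
pose Z := \sum_s `|q s|.
have Z_gt0 : 0 < Z.
  rewrite lt_def sumr_ge0 // andbT; apply: contra vN0 => /eqP Z0.
  apply/eqP/rowP => i; rewrite mxE -[i]enum_valK; apply/eqP.
  by rewrite -normr_eq0 -/(q _) (psumr_eq0P _ Z0).
(* The zero summand brings a mere rescaling into the shape of [invariantD]. *)
exists (fun s => Z^-1 * `|q s| + 0 * `|q s|); split.
- by move=> s; rewrite mul0r addr0 mulr_ge0 // invr_ge0 ltW.
- under eq_bigr do rewrite mul0r addr0.
  by rewrite -mulr_sumr mulVf // gt_eqF.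
- by apply: invariantD; apply: invariant_norm.
Qed.

(** If [p] vanished at [T e s], the balance equation there would force every inflow to be zero,
    including the positive one from [s] through [e]. *)
Lemma invariant_support (p : S -> R) e s :
  (forall s, 0 <= p s) -> invariant p -> 0 < c e -> 0 < p s -> 0 < p (T e s).
Proof.
move=> p_ge0 /invariantP/(_ (T e s)) pW ce ps.
rewrite lt_def p_ge0 andbT; apply/eqP => pT0.
move: pW; rewrite pT0 mulr0 => /psumr_eq0P pw0.
have /eqP := pw0 (fun t _ => mulr_ge0 (p_ge0 t) (weight_ge0 _ _)) s isT.
rewrite mulf_eq0 gt_eqF //= => /eqP /psumr_eq0P w0.
have /eqP := w0 (fun e' _ => mulr_ge0 (c_ge0 e') (ler0n _ _)) e isT.
by rewrite eqxx mulr1 gt_eqF.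
Qed.

Variables (V : S -> nat) (omega : S).
Hypothesis V_descent :
  forall s, s != omega -> exists2 e, 0 < c e & (V (T e s) < V s)%N.

Lemma invariant_sink (p : S -> R) s :
  (forall s, 0 <= p s) -> invariant p -> 0 < p s -> 0 < p omega.
Proof.
move=> p_ge0 pI; have [n] := ubnP (V s); elim: n s => // n IHn s Vs ps.
have [<- // | /V_descent[e ce Ve]] := eqVneq s omega.
apply: (IHn (T e s)); first exact: leq_trans Ve _.
exact: invariant_support.
Qed.

(** Applied to the difference of two invariant distributions, this gives uniqueness. Since [q] has
    sum 0, both |q| + q and |q| - q have the mass of |q|. If that mass is not zero, [invariant_sink]
    makes both positive at [omega], where one of them vanishes. *)
Lemma invariant_sum0 (q : S -> R) :
  invariant q -> \sum_s q s = 0 -> forall s, q s = 0.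
Proof.
move=> qI q0; have aI := invariant_norm qI.
pose m (b : R) s := `|q s| + b * q s.
have mI b : invariant (m b).
  move=> phi; rewrite -[RHS](invariantD 1 b aI qI phi).
  by apply: eq_bigr => s _; rewrite /m mul1r.
have sum_m b : \sum_s m b s = \sum_s `|q s|.
  by rewrite big_split /= -mulr_sumr q0 mulr0 addr0.
have [Z0 | ZN0] := eqVneq (\sum_s `|q s|) 0.
  by move=> s; apply/eqP; rewrite -normr_eq0 (psumr_eq0P _ Z0).
have m_omega b : `|b| <= 1 -> 0 < m b omega.
  move=> b1; have m_ge0 s : 0 <= m b s.
    have /lerNnormlW : `|b * q s| <= `|q s| by rewrite normrM ler_piMl.
    by rewrite /m; lra.
  have [s ms] : exists s, 0 < m b s.
    apply: contrapT => /forallNP mN; case/eqP: ZN0; rewrite -(sum_m b) big1 //.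
    by move=> s _; apply/eqP; rewrite eq_le m_ge0 leNgt andbT; apply/negP/mN.
  exact: invariant_sink ms.
have := m_omega 1; have := m_omega (-1); rewrite /m normrN normr1.
by case: ger0P; lra.
Qed.

End ClockChain.

(** * Escape estimates in powers of the small rate *)

Section Escape.
Variables (R : realFieldType) (S E : finType) (r : R).
Variable T : option E -> S -> S.

Definition clock_rate (e : option E) : R := if e is Some _ then 1 else r.

Lemma clock_rate_ge0 : 0 <= r -> forall e, 0 <= clock_rate e.
Proof. by move=> r0 [e|] /=. Qed.

Variables (p : S -> R) (V : S -> nat) (K : nat).
Hypothesis r_ge0 : 0 <= r.
Hypothesis p_ge0 : forall s, 0 <= p s.
Hypothesis p_invariant : invariant clock_rate T p.
Hypothesis V_le : forall e s, (V (T (Some e) s) <= V s)%N.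
Hypothesis V_lt : forall s, (0 < V s)%N -> exists e, (V (T (Some e) s) < V s)%N.
Hypothesis V_bound : forall s, (V s <= K)%N.

(* The test function is V outside Y: clocks of rate 1 decrease it by at least 1
   on average, and only a clock of rate r rung outside X can increase it. *)
Lemma escape_le (X Y : pred S) :
  (forall e s, Y s -> Y (T (Some e) s)) ->
  (forall s, X s -> Y (T None s)) ->
  (forall s, V s = 0%N -> Y s) ->
  \sum_(s | ~~ Y s) p s <= r * K%:R * \sum_(s | ~~ X s) p s.
Proof.
move=> YT XY Y0.
pose h s : R := if Y s then 0 else (V s)%:R.
have h_ge0 s : 0 <= h s by rewrite /h; case: ifP.
have h_le s : h s <= (V s)%:R by rewrite /h; case: ifP.
have driftE s : drift clock_rate T h s =
    r * (h (T None s) - h s) + \sum_e (h (T (Some e) s) - h s).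
  rewrite /drift (bigD1 None) //=; congr (_ + _).
  rewrite (reindex_omap Some id) /=; last by case.
  by apply: eq_big => [e | e _]; rewrite ?eqxx // mul1r.
have cross_le s : r * (h (T None s) - h s) <= r * K%:R * (~~ X s)%:R.
  rewrite -mulrA ler_wpM2l //; have [/XY YTs | _] := boolP (X s).
    by rewrite mulr0 {1}/h YTs sub0r oppr_le0.
  rewrite mulr1 lerBlDr; apply: le_trans (h_le _) _.
  by apply: le_trans (_ : K%:R <= _); rewrite ?ler_nat // lerDl.
have move_le s : \sum_e (h (T (Some e) s) - h s) <= - (~~ Y s)%:R.
  have hT e : h (T (Some e) s) - h s <= 0.
    rewrite subr_le0 /h; have [/(YT e) -> // | _] := boolP (Y s).
    by apply: le_trans (h_le _) _; rewrite ler_nat.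
  have [Ys | YNs] := boolP (Y s); first by rewrite oppr0 sumr_le0.
  have [e Ve] : exists e, (V (T (Some e) s) < V s)%N.
    by apply: V_lt; rewrite lt0n; apply: contra YNs => /eqP /Y0.
  rewrite (bigD1 e) //= -[leRHS]addr0 lerD ?sumr_le0 //.
  rewrite lerBlDr {2}/h (negPf YNs); apply: le_trans (h_le _) _.
  by rewrite addrC lerBrDr -natrD ler_nat addn1.
have sum_not (P : pred S) :
    \sum_s p s * (~~ P s)%:R = \sum_(s | ~~ P s) p s.
  by rewrite [RHS]big_mkcond; apply: eq_bigr => s _; rewrite mulr_natr mulrb.
have : 0 <= \sum_s p s * (r * K%:R * (~~ X s)%:R - (~~ Y s)%:R).
  rewrite -[leLHS](p_invariant h); apply: ler_sum => s _.
  by rewrite ler_wpM2l // driftE lerD.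
under eq_bigr do rewrite mulrBr mulrCA.
by rewrite sumrB -mulr_sumr subr_ge0 !sum_not.
Qed.

Lemma escape_iter (Y : nat -> pred S) (N : nat) :
  \sum_s p s = 1 ->
  (forall n e s, Y n s -> Y n (T (Some e) s)) ->
  (forall n s, (n < N)%N -> Y n s -> Y n.+1 (T None s)) ->
  (forall n s, V s = 0%N -> Y n s) ->
  \sum_(s | ~~ Y N s) p s <= (r * K%:R) ^+ N.+1.
Proof.
move=> p1 YT YS Y0.
have rK_ge0 : 0 <= r * K%:R by rewrite mulr_ge0.
elim: {-2}N (leqnn N) => [_ | n IHn nN].
  (* With [X] empty the right-hand sum is the total mass 1. So [Y 0] already yields one factor,
     whence the exponent [N.+1]. *)
  rewrite expr1; apply: le_trans (escape_le (X := pred0) (YT 0) _ (Y0 0)) _ => //.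
  by rewrite p1 mulr1.
apply: le_trans (escape_le (X := Y n) (YT n.+1) _ (Y0 n.+1)) _.
  by move=> s; apply: YS.
by rewrite exprS ler_wpM2l // IHn // ltnW.
Qed.

End Escape.

(** * Defects *)

(* [side = false] is the left half; positions are distances from the blockage. *)
Definition pos (side : bool) (j : nat) : int :=
  if side then 1 + j%:Z else - j%:Z.

Lemma pos_inj side side' j j' :
  (pos side j == pos side' j') = (side == side') && (j == j').
Proof. by rewrite /pos; case: side; case: side' => /=; lia. Qed.

Section Defects.
Variable L : nat.
Implicit Types eta : config L.

Lemma site_inj : injective (@site L).
Proof. by move=> i j; rewrite /site => h; apply: val_inj => /=; lia. Qed.

Lemma occupied_site eta i : occupied eta (site i) = eta i.
Proof.
apply/existsP/idP => [[j /andP[/eqP/site_inj-> //]] | etai].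
by exists i; rewrite eqxx.
Qed.

Lemma site_pos side j : (j < L)%N -> exists i : 'I_(2 * L), site i = pos side j.
Proof.
move=> jL; have iL : ((if side then L + j else L - j.+1) < 2 * L)%N.
  by case: side; lia.
by exists (Ordinal iL); rewrite /site /pos /=; case: side iL; lia.
Qed.

Lemma pos_site (i : 'I_(2 * L)) :
  exists side, exists2 j, (j < L)%N & site i = pos side j.
Proof.
have iL := ltn_ord i.
by have [h|h] := leqP L i; [exists true, (i - L)%N | exists false, (L - i.+1)%N];
  rewrite /site /pos; lia.
Qed.

Lemma update_outside eta side j b : (L <= j)%N -> update eta (pos side j) b = eta.
Proof.
move=> Lj; apply/ffunP => i; rewrite ffunE.
have [side' [j' j'L ->]] := pos_site i.
by rewrite pos_inj; case: ifP => // /andP[_ /eqP]; lia.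
Qed.

Lemma update_comm eta k k' b b' : k != k' ->
  update (update eta k b) k' b' = update (update eta k' b') k b.
Proof.
move=> kk'; apply/ffunP => i; rewrite !ffunE.
by have [-> | //] := eqVneq (site i) k; rewrite (negPf kk').
Qed.

(** The bound [j < L] declares all positions outside the system free of defects, so that leaving it
    becomes an ordinary [move]. *)
Definition defect eta (side : bool) (j : nat) : bool :=
  (j < L)%N && (occupied eta (pos side j) == side).

Definition set_defect eta (side : bool) (j : nat) (b : bool) : config L :=
  update eta (pos side j) (b == side).

Lemma defect_set eta side j b side' j' :
  defect (set_defect eta side j b) side' j' =
    if [&& side' == side, j' == j & (j < L)%N] then b else defect eta side' j'.
Proof.
rewrite /defect; have [j'L | Lj'] := ltnP j' L; last by case: ifP => // /and3P[]; lia.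
have [i iE] := site_pos side' j'L; rewrite -iE !occupied_site ffunE iE pos_inj.
have [-> | _] //= := eqVneq side' side.
have [<- | _] //= := eqVneq j' j.
by rewrite j'L; case: (side); case: b.
Qed.

Lemma defect_ge eta side j : (L <= j)%N -> defect eta side j = false.
Proof. by move=> Lj; rewrite /defect ltnNge Lj. Qed.

Lemma defect_eq eta xi :
  (forall side j, defect eta side j = defect xi side j) -> eta = xi.
Proof.
move=> h; apply/ffunP => i; have [side [j jL iE]] := pos_site i.
have := h side j; rewrite /defect jL /= -iE !occupied_site.
by case: (side); case: (eta i); case: (xi i).
Qed.

Definition move eta (side : bool) (j : nat) : config L :=
  if defect eta side j && ~~ defect eta side j.+1
  then set_defect (set_defect eta side j false) side j.+1 true else eta.

Definition cross eta : config L :=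
  if ~~ defect eta false 0 && ~~ defect eta true 0
  then set_defect (set_defect eta false 0 true) true 0 true else eta.

(** [M] may exceed [L]: clocks at positions [j >= L] do nothing, so systems of different sizes can
    share one set of clocks. *)
Definition act (M : nat) (e : option (bool * 'I_M)) eta : config L :=
  if e is Some (side, j) then move eta side j else cross eta.

Lemma move_ge eta side j : (L <= j)%N -> move eta side j = eta.
Proof. by move=> Lj; rewrite /move defect_ge. Qed.

Variables (R : realType) (r : R).
Hypothesis L_gt0 : (0 < L)%N.
Variables (eta : config L) (phi : config L -> R).

Let gain (k : int) : R :=
  if occupied eta k && ~~ occupied eta (k + 1)
  then phi (update (update eta k false) (k + 1) true) - phi eta else 0.

Let sum_if (P : bool) (a : R) zeta :
  \sum_xi (if P && (xi == zeta) then a else 0) * (phi xi - phi eta) =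
  if P then a * (phi zeta - phi eta) else 0.
Proof.
case: P => /=; last by rewrite big1 // => xi _; rewrite mul0r.
rewrite (bigD1 zeta) //= eqxx big1 ?addr0 // => xi /negPf ->.
by rewrite mul0r.
Qed.

Lemma sum_jump_rate k :
  \sum_xi jump_rate r k eta xi * (phi xi - phi eta) =
  (if k == 0 then r else 1) * gain k.
Proof.
rewrite /jump_rate; under eq_bigr do rewrite andbA.
by rewrite sum_if /gain; case: ifP => // _; rewrite mulr0.
Qed.

(** On the left half, a particle jumping towards the blockage is a hole moving away from it. *)
Lemma gain_left j : (j.+1 < L)%N ->
  gain (- j.+1%:Z) = phi (move eta false j) - phi eta.
Proof.
move=> jL; rewrite /gain /move /defect /set_defect jL (ltnW jL) /=.
have -> : - j.+1%:Z + 1 = - j%:Z by lia.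
rewrite update_comm; last by lia.
by case: (occupied _ (- j%:Z)); case: (occupied _ (- j.+1%:Z));
  rewrite //= subrr.
Qed.

Lemma gain_right j : (j.+1 < L)%N ->
  gain (1 + j%:Z) = phi (move eta true j) - phi eta.
Proof.
move=> jL; rewrite /gain /move /defect /set_defect jL (ltnW jL) /=.
have -> : 1 + j%:Z + 1 = 1 + j.+1%:Z by lia.
by case: (occupied _ (1 + j%:Z)); case: (occupied _ (1 + j.+1%:Z));
  rewrite //= subrr.
Qed.

Lemma gain_cross : gain 0 = phi (cross eta) - phi eta.
Proof.
rewrite /gain /cross /defect /set_defect L_gt0 /= oppr0 addr0 add0r.
by case: (occupied _ 0); case: (occupied _ 1); rewrite //= subrr.
Qed.

(** Entry fills a hole at the outermost distance [L.-1]. As a [move], its target [L] lies outside,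
    where [set_defect] has no effect. *)
Lemma sum_entry_rate :
  \sum_xi entry_rate R eta xi * (phi xi - phi eta) =
  phi (move eta false L.-1) - phi eta.
Proof.
rewrite /entry_rate sum_if mul1r /move (prednK L_gt0) (defect_ge _ _ (leqnn L)).
rewrite /set_defect update_outside // /defect prednK // leqnn /=.
have -> : - L%:Z + 1 = - L.-1%:Z by lia.
by rewrite andbT; case: (occupied _ _) => //=; rewrite subrr.
Qed.

Lemma sum_exit_rate :
  \sum_xi exit_rate R eta xi * (phi xi - phi eta) =
  phi (move eta true L.-1) - phi eta.
Proof.
rewrite /exit_rate sum_if mul1r /move (prednK L_gt0) (defect_ge _ _ (leqnn L)).
rewrite /set_defect update_outside // /defect prednK // leqnn /=.
have -> : (L%:Z) = 1 + L.-1%:Z by lia.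
by rewrite andbT; case: (occupied _ _) => //=; rewrite subrr.
Qed.

(** Translates the particle dynamics into defect dynamics. The bonds split at index [L.-1], the
    blockage, into left ones, read backwards, and right ones; entry and exit supply the two
    outermost moves. *)
Lemma sum_generator (M : nat) : (L <= M)%N ->
  \sum_xi generator r eta xi * phi xi =
  drift (@clock_rate _ _ r) (@act M) phi eta.
Proof.
move=> LM.
transitivity (\sum_xi rate r eta xi * (phi xi - phi eta)).
  under eq_bigr do rewrite mulrBl.
  under [RHS]eq_bigr do rewrite mulrBr.
  rewrite !sumrB -mulr_suml; congr (_ - _).
  set Z := \sum_zeta rate r eta zeta; rewrite (bigD1 eta) //= eqxx big1 ?addr0 // => xi.
  by move=> /negPf ->; rewrite mul0r.
have -> : drift (@clock_rate _ _ r) (@act M) phi eta =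
    r * (phi (cross eta) - phi eta) +
    \sum_side \sum_(0 <= j < L) (phi (move eta side j) - phi eta).
  rewrite /drift (bigD1 None) //=; congr (_ + _).
  rewrite (reindex_omap Some id) /=; last by case.
  rewrite (eq_bigl xpredT) => [|e]; last by rewrite eqxx.
  rewrite (eq_bigr (fun e : bool * 'I_M => phi (move eta e.1 e.2) - phi eta));
    last by case=> side j _; rewrite mul1r.
  rewrite -(pair_bigA _ (fun side (j : 'I_M) => phi (move eta side j) - phi eta)).
  apply: eq_bigr => side _ /=.
  rewrite -(big_mkord xpredT (fun j => phi (move eta side j) - phi eta)).
  rewrite (big_cat_nat (leq0n L) LM) /= [X in _ + X]big_nat_cond [X in _ + X]big1 ?addr0 //.
  by move=> j /andP[/andP[Lj _] _]; rewrite move_ge // subrr.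
rewrite /rate; under eq_bigr do rewrite !mulrDl mulr_suml.
rewrite !big_split /= sum_entry_rate sum_exit_rate exchange_big /=.
under eq_bigr do rewrite sum_jump_rate.
pose F (i : nat) : R := let k := i%:Z - L%:Z + 1 in (if k == 0 then r else 1) * gain k.
rewrite (eq_bigl (fun i : 'I_(2 * L) => (i < (2 * L).-1)%N)); last first.
  by move=> i; rewrite /site; lia.
rewrite -(big_ord_widen _ F (leq_pred _)).
rewrite -(big_mkord xpredT F) (@big_cat_nat _ _ _ L.-1) //=; last by lia.
rewrite (@big_ltn _ _ _ L.-1); last by lia.
have FL : F L.-1 = r * (phi (cross eta) - phi eta).
  rewrite /F; have -> : L.-1%:Z - L%:Z + 1 = 0 by lia.
  by rewrite gain_cross.
have Fleft : \sum_(0 <= i < L.-1) F i =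
    \sum_(0 <= j < L.-1) (phi (move eta false j) - phi eta).
  rewrite big_nat_rev; apply: eq_big_nat => j /andP[_ jL].
  rewrite /F; have -> : (0 + L.-1 - j.+1)%N%:Z - L%:Z + 1 = - j.+1%:Z by lia.
  by rewrite gain_left ?mul1r //; lia.
have Fright : \sum_(L.-1.+1 <= i < (2 * L).-1) F i =
    \sum_(0 <= j < L.-1) (phi (move eta true j) - phi eta).
  rewrite prednK // -{1}[L]add0n big_addn.
  have -> : ((2 * L).-1 - L = L.-1)%N by lia.
  apply: eq_big_nat => j /andP[_ jL].
  rewrite /F; have -> : (j + L)%N%:Z - L%:Z + 1 = 1 + j%:Z by lia.
  by rewrite gain_right ?mul1r //; lia.
rewrite FL Fleft Fright big_bool -[in RHS](prednK L_gt0) !big_nat_recr //=.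
by rewrite ?prednK //; ring.
Qed.

End Defects.

(** * Numbers of defects near the blockage *)

Section Counts.
Variable L : nat.
Implicit Types eta : config L.

Definition count_defects eta side K : nat := \sum_(0 <= j < K) defect eta side j.

Lemma count_defects0 eta side : count_defects eta side 0 = 0%N.
Proof. by rewrite /count_defects big_nil. Qed.

Lemma count_defectsS eta side K :
  count_defects eta side K.+1 = (count_defects eta side K + defect eta side K)%N.
Proof. by rewrite /count_defects big_nat_recr. Qed.

Lemma count_defects_set eta side j b side' K :
  (count_defects (set_defect eta side j b) side' K +
     [&& side' == side, j < K & j < L] * defect eta side j =
   count_defects eta side' K + [&& side' == side, j < K & j < L] * b)%N.
Proof.
elim: K => [|K IHK]; first by rewrite !count_defects0 ltn0 !andbF.
move: IHK; rewrite !count_defectsS defect_set ltnS.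
have [-> | _] /= := eqVneq side' side; last by lia.
by have [->|jK] := eqVneq K j; case: (ltnP j L) => jL /=; rewrite ?ltnn ?leqnn /=; lia.
Qed.

(** Only the window ending between [j] and [j.+1] loses a defect. An exit would also lower the
    windows with [K > L], hence the restriction on [K]. *)
Lemma count_defects_move eta side j side' K : (K <= L)%N ->
  (count_defects (move eta side j) side' K +
     [&& side' == side, K == j.+1, defect eta side j & ~~ defect eta side j.+1] =
   count_defects eta side' K)%N.
Proof.
move=> KL; rewrite /move; case: ifP => [/andP[dj dj1] | /negbT].
  have := count_defects_set eta side j false side' K.
  have := count_defects_set (set_defect eta side j false) side j.+1 true side' K.
  rewrite defect_set dj (negPf dj1) eqxx /= gtn_eqF //=.
  by case: eqP => _ /=; lia.
by case: (side' == side) => //=; case: (defect _ _ j) => //=; lia.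
Qed.

Lemma count_defects_move_le eta side j side' K :
  (count_defects (move eta side j) side' K <= count_defects eta side' K)%N.
Proof.
rewrite /move; case: ifP => // /andP[dj dj1].
have := count_defects_set eta side j false side' K.
have := count_defects_set (set_defect eta side j false) side j.+1 true side' K.
rewrite defect_set dj (negPf dj1) eqxx /= gtn_eqF //=.
by case: eqP => _ /=; lia.
Qed.

Lemma count_defects_cross eta side K : (0 < L)%N ->
  count_defects (cross eta) side K =
    (count_defects eta side K +
     [&& 0 < K, ~~ defect eta false 0 & ~~ defect eta true 0])%N.
Proof.
move=> L_gt0; rewrite /cross; case: ifP => [/andP[d0 d1] | _]; last by lia.
have := count_defects_set eta false 0 true side K.
have := count_defects_set (set_defect eta false 0 true) true 0 true side K.
rewrite defect_set (negPf d0) (negPf d1) L_gt0 /=.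
by case: side => /=; lia.
Qed.

(** A defect at [j] lies in the windows [K = j+1, ..., L], so this is the total number of moves
    after which all present defects have left. *)
Definition potential eta : nat :=
  \sum_side \sum_(K < L.+1) count_defects eta side K.

Lemma potential_move_le eta side j : (potential (move eta side j) <= potential eta)%N.
Proof.
by apply: leq_sum => s _; apply: leq_sum => K _; apply: count_defects_move_le.
Qed.

Lemma potential_eq0 eta : potential eta = 0%N ->
  forall side K, (K <= L)%N -> count_defects eta side K = 0%N.
Proof.
move=> /eqP; rewrite sum_nat_eq0 => /forallP h side K KL.
have := h side; rewrite sum_nat_eq0 => /forallP/(_ (inord K)) /=.
by rewrite inordK ?ltnS // => /eqP.
Qed.

Lemma defect_eq0 eta : (forall side K, (K <= L)%N -> count_defects eta side K = 0%N) ->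
  forall side j, defect eta side j = false.
Proof.
move=> h side j; have [/defect_ge -> // | jL] := leqP L j.
by have := h side _ jL; rewrite count_defectsS; case: defect; rewrite ?addn1.
Qed.

(** If no defect could move, each would have another just outside it, and so on up to position [L],
    where there is none. *)
Lemma potential_move_lt eta : (0 < potential eta)%N ->
  exists side (j : 'I_L), (potential (move eta side j) < potential eta)%N.
Proof.
move=> V_gt0.
have [[side [j [dj dj1]]] | none] := pselect (exists side j,
    defect eta side j /\ ~~ defect eta side j.+1).
  have jL : (j < L)%N by move: dj => /andP[].
  exists side, (Ordinal jL) => /=.
  rewrite /potential (bigD1 side) // [ltnRHS](bigD1 side) //=.
  rewrite -addSn leq_add //; last first.
    by apply: leq_sum => s _; apply: leq_sum => K _; apply: count_defects_move_le.
  rewrite (bigD1 (inord j.+1)) // [ltnRHS](bigD1 (inord j.+1)) //=.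
  rewrite -addSn leq_add //; last first.
    by apply: leq_sum => K _; apply: count_defects_move_le.
  rewrite inordK // -(count_defects_move eta side j side jL) !eqxx dj dj1 /=.
  by rewrite addn1.
have stay side j : defect eta side j -> defect eta side j.+1.
  by move=> dj; apply: contrapT => /negP dj1; apply: none; exists side, j.
have dF side j : defect eta side j = false.
  have {}stay k : defect eta side j -> defect eta side (j + k).
    by elim: k => [|k IHk]; rewrite ?addn0 // addnS => /IHk/stay.
  by apply/negP => /(stay L); rewrite defect_ge // leq_addl.
move: V_gt0; rewrite /potential big1 // => side _; rewrite big1 // => K _.
by rewrite /count_defects big1 // => j _; rewrite dF.
Qed.

Definition step_config : config L := [ffun i => site i <= 0].

Lemma defect_step_config side j : defect step_config side j = false.
Proof.
rewrite /defect; case: ltnP => //= jL; have [i iE] := site_pos side jL.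
rewrite -iE occupied_site ffunE iE /pos.
by case: side {iE}; lia.
Qed.

Lemma potential_descent eta : eta != step_config ->
  exists side (j : 'I_L), (potential (move eta side j) < potential eta)%N.
Proof.
move=> etaN; apply: potential_move_lt; rewrite lt0n; apply: contra etaN => /eqP V0.
apply/eqP/defect_eq => side j; rewrite defect_step_config.
exact: defect_eq0 (potential_eq0 V0) _ _.
Qed.

End Counts.

(** * Agreement of the two systems near the blockage *)

Section Compatible.
Variables L1 L2 : nat.
Hypothesis L1_gt0 : (0 < L1)%N.
Hypothesis L12 : (L1 <= L2)%N.
Implicit Types (xi : config L2) (eta : config L1).

(* Number the n defects created so far on one side in order of creation, those
   which have left included.  The i-th oldest is at the same place in both
   systems as long as it is at least i steps away from leaving the smaller one:
   the boundaries act differently only through a queue of defects reaching back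
   to the exit of the smaller system.  In terms of the number of defects among
   the K sites closest to the blockage, this becomes the condition below. *)
Definition compatible (n : nat) xi eta (side : bool) : Prop :=
  (forall K, (K <= L1)%N ->
     count_defects xi side K = count_defects eta side K \/
     (count_defects xi side K + L1 < n + K)%N /\
     (count_defects eta side K + L1 < n + K)%N) /\
  (forall K, (count_defects xi side K <= n)%N /\ (count_defects eta side K <= n)%N).

(** Only the window [K = j.+1] matters. If the counts agree there and just one system moves, then
    they disagreed before at [K = j] or at [K = j.+2], and the strict bounds known there give those
    needed at [j.+1]. *)
Lemma compatible_move n xi eta side side' j :
  compatible n xi eta side' ->
  compatible n (move xi side j) (move eta side j) side'.
Proof.
move=> [near total]; split=> K; last first.
  by have [] := total K; split; apply: leq_trans (count_defects_move_le _ _ _ _ _) _.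
move=> KL1; have KL2 := leq_trans KL1 L12.
have := count_defects_move xi side j side' KL2.
have := count_defects_move eta side j side' KL1.
have [E | _] /= := eqVneq side' side; last first.
  by rewrite !addn0 => -> ->; apply: near.
subst side'.
have [Kj | _] /= := eqVneq K j.+1; last first.
  by rewrite !addn0 => -> ->; apply: near.
subst K => /=.
have [t1 t2] := total j.+2; have [t3 t4] := total j.+1.
have n1 := near _ KL1; have n0 := near _ (ltnW KL1).
(* At the exit of the smaller system there is no condition at [j.+2]. A defect blocking the larger
   system there is instead counted by the bound [n] on its total. *)
have n2 : (L1 <= j.+1)%N \/ count_defects xi side j.+2 = count_defects eta side j.+2 \/
     (count_defects xi side j.+2 + L1 < n + j.+2)%N /\
     (count_defects eta side j.+2 + L1 < n + j.+2)%N.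
  by have [|/near] := leqP L1 j.+1; [left | right].
move: t1 t2 t3 t4 n1 n0 n2; rewrite !count_defectsS.
by case: (defect xi _ j); case: (defect xi _ j.+1);
  case: (defect eta _ j); case: (defect eta _ j.+1) => /=; lia.
Qed.

(** A disagreement at [K = 1] means that one count is 1, and then [1 + L1 < n + 1]. *)
Lemma compatible_defect0 n xi eta side : (n <= L1)%N ->
  compatible n xi eta side -> defect xi side 0 = defect eta side 0.
Proof.
move=> nL1 [/(_ 1%N L1_gt0) near _]; move: near; rewrite !count_defectsS !count_defects0.
by case: (defect xi _ _); case: (defect eta _ _) => /=; lia.
Qed.

(** By [compatible_defect0] the blocked jump happens in both systems or in neither, so the counts
    grow together, by at most the increase of [n]. *)
Lemma compatible_cross n xi eta : (n < L1)%N ->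
  (forall side, compatible n xi eta side) ->
  forall side, compatible n.+1 (cross xi) (cross eta) side.
Proof.
move=> nL1 h side; have nL1' := ltnW nL1.
have L2_gt0 := leq_trans L1_gt0 L12.
have [near total] := h side.
split=> K; rewrite !count_defects_cross // !(compatible_defect0 nL1' (h _)).
  by move=> KL1; have := near _ KL1; lia.
by have := total K; lia.
Qed.

End Compatible.

(** * The coupled system *)

Section Image.
Variables (R : realFieldType) (S S' : finType) (f : S -> S').

Definition image_measure (p : S -> R) (t : S') : R := \sum_(s | f s == t) p s.

Lemma sum_image_measure (p : S -> R) (g : S' -> R) :
  \sum_t image_measure p t * g t = \sum_s p s * g (f s).
Proof.
rewrite [RHS](partition_big f xpredT) //=; apply: eq_bigr => t _.
by rewrite mulr_suml; apply: eq_bigr => s /eqP->.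
Qed.

Variables (E : finType) (c : E -> R) (T : E -> S -> S) (T' : E -> S' -> S').

Lemma invariant_image (p : S -> R) : (forall e s, f (T e s) = T' e (f s)) ->
  invariant c T p -> invariant c T' (image_measure p).
Proof.
move=> fT pI phi; rewrite sum_image_measure -[RHS](pI (phi \o f)).
apply: eq_bigr => s _; congr (_ * _); apply: eq_bigr => e _ /=.
by rewrite fT.
Qed.

End Image.

(** * Uniqueness of the stationary distribution *)

Section Stationary.
Variables (R : realType) (L M : nat) (r : R).
Hypotheses (L_gt0 : (0 < L)%N) (LM : (L <= M)%N).

Lemma stationary_invariant (p : {ffun config L -> R}) : stationary r p <->
  [/\ forall eta, 0 <= p eta, \sum_eta p eta = 1 &
      invariant (@clock_rate _ _ r) (@act L M) p].
Proof.
split=> -[p_ge0 p1 pI]; split=> //.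
  move=> phi.
  under eq_bigr do rewrite -(sum_generator _ L_gt0) // mulr_sumr.
  rewrite exchange_big big1 // => xi _.
  under eq_bigr do rewrite mulrA.
  by rewrite -mulr_suml pI mul0r.
move=> xi; rewrite -[RHS](pI (fun zeta => (zeta == xi)%:R)); apply: eq_bigr => eta _.
by rewrite -(sum_generator _ L_gt0) // sum_delta.
Qed.

(** Clocks of rate 1 lead from every configuration to [step_config], so [invariant_sum0] annihilates
    the difference of two stationary laws. *)
Lemma stationary_distributionE (p : config L -> R) : 0 <= r ->
  (forall eta, 0 <= p eta) -> \sum_eta p eta = 1 ->
  invariant (@clock_rate _ _ r) (@act L M) p ->
  stationary_distribution L r = finfun p.
Proof.
move=> r_ge0 p_ge0 p1 pI; apply: xget_unique.
  apply/stationary_invariant; split=> [eta||phi]; first by rewrite ffunE.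
    by under eq_bigr do rewrite ffunE.
  by under eq_bigr do rewrite ffunE; apply: pI.
move=> q /stationary_invariant[q_ge0 q1 qI]; apply/ffunP => eta; rewrite ffunE.
have descent xi : xi != step_config L -> exists2 e : option (bool * 'I_M),
    0 < clock_rate r e & (potential (act e xi) < potential xi)%N.
  move=> /potential_descent[side [j lt_V]].
  by exists (Some (side, widen_ord LM j)) => //=; rewrite ltr01.
have sum_qp : \sum_xi (1 * q xi + -1 * p xi) = 0.
  by rewrite big_split /= -!mulr_sumr q1 p1 mul1r mulN1r subrr.
have := invariant_sum0 (clock_rate_ge0 r_ge0) descent (invariantD 1 (-1) qI pI) sum_qp eta.
by rewrite mul1r mulN1r => /eqP; rewrite subr_eq0 => /eqP.
Qed.

End Stationary.

(** * Coupling by common clocks and comparison of the currents *)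

Section Coupling.
Variables (R : realType) (L1 L2 : nat).
Hypotheses (L1_gt0 : (0 < L1)%N) (L12 : (L1 <= L2)%N).

Let state := (config L2 * config L1)%type.

Definition couple (e : option (bool * 'I_L2)) (s : state) : state :=
  (act e s.1, act e s.2).

Definition couple_potential (s : state) : nat := (potential s.1 + potential s.2)%N.

Definition compatible_pair (n : nat) : pred state :=
  fun s => `[< forall side, compatible n s.1 s.2 side >].

Lemma couple_potential_le e s :
  (couple_potential (couple (Some e) s) <= couple_potential s)%N.
Proof. by case: e => side j; rewrite leq_add // potential_move_le. Qed.

Lemma couple_potential_lt s : (0 < couple_potential s)%N ->
  exists e, (couple_potential (couple (Some e) s) < couple_potential s)%N.
Proof.
case: s => xi eta; rewrite addn_gt0 => /orP[] /potential_move_lt[side [j lt_V]].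
  exists (side, j); rewrite /couple_potential /= -addSn leq_add //.
  exact: potential_move_le.
exists (side, widen_ord L12 j); rewrite /couple_potential /= -addnS leq_add //.
exact: potential_move_le.
Qed.

Lemma compatible_pair_move n e s :
  compatible_pair n s -> compatible_pair n (couple (Some e) s).
Proof.
by case: e => side j /asboolP h; apply/asboolP => side'; apply: compatible_move.
Qed.

Lemma compatible_pair_cross n s : (n < L1)%N ->
  compatible_pair n s -> compatible_pair n.+1 (couple None s).
Proof. by move=> nL1 /asboolP h; apply/asboolP; apply: compatible_cross. Qed.

Lemma compatible_pair0 n s : couple_potential s = 0%N -> compatible_pair n s.
Proof.
case: s => xi eta /eqP; rewrite addn_eq0 => /andP[/eqP V2 /eqP V1].
have d2 := defect_eq0 (potential_eq0 V2); have d1 := defect_eq0 (potential_eq0 V1).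
apply/asboolP => side; have c2 K : count_defects xi side K = 0%N.
  by rewrite /count_defects big1 // => j _; rewrite d2.
have c1 K : count_defects eta side K = 0%N.
  by rewrite /count_defects big1 // => j _; rewrite d1.
by split=> K /=; rewrite c1 c2; [left | split].
Qed.

(** Each marginal of an invariant law of the coupled chain is stationary, so both currents become
    integrals against the same [p]. *)
Lemma current_integral (L : nat) (r : R) (p : state -> R) (f : state -> config L) :
  (0 < L)%N -> (L <= L2)%N -> 0 <= r -> (forall s, 0 <= p s) -> \sum_s p s = 1 ->
  invariant (@clock_rate _ _ r) couple p -> (forall e s, f (couple e s) = act e (f s)) ->
  current L r =
    r * \sum_s p s * (~~ defect (f s) false 0 && ~~ defect (f s) true 0)%:R.
Proof.
move=> L_gt0 LL2 r_ge0 p_ge0 p1 pI fT.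
rewrite /current (stationary_distributionE (p := image_measure f p) L_gt0 LL2) //.
- congr (_ * _).
  rewrite -(sum_image_measure f p (fun eta =>
    (~~ defect eta false 0 && ~~ defect eta true 0)%:R)) big_mkcond.
  apply: eq_bigr => eta _; rewrite ffunE mulr_natr mulrb.
  rewrite /defect L_gt0 /pos /= oppr0 addr0.
  by case: (occupied eta 0); case: (occupied eta 1).
- by move=> eta; apply: sumr_ge0.
- have := sum_image_measure f p (fun=> 1).
  under eq_bigr do rewrite mulr1.
  by under [X in _ = X]eq_bigr do rewrite mulr1; rewrite p1.
- exact: invariant_image fT pI.
Qed.

Lemma current_le (r : R) : 0 < r ->
  `|current L2 r - current L1 r| <=
    (\max_s couple_potential s)%:R ^+ L1.+1 * r ^+ (L1 + 2).
Proof.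
move=> r_gt0; have r_ge0 := ltW r_gt0.
have [p [p_ge0 p1 pI]] := @invariant_exists _ _ _ _ couple
  (clock_rate_ge0 r_ge0) (step_config L2, step_config L1).
have L2_gt0 := leq_trans L1_gt0 L12.
rewrite (current_integral (f := fst) L2_gt0 (leqnn _) r_ge0 p_ge0 p1 pI) //.
rewrite (current_integral (f := snd) L1_gt0 L12 r_ge0 p_ge0 p1 pI) //.
rewrite -mulrBr -sumrB normrM ger0_norm // addn2 [r ^+ _]exprS mulrCA ler_wpM2l //.
rewrite -exprMn mulrC.
have V_bound s : (couple_potential s <= \max_s couple_potential s)%N.
  exact: leq_bigmax.
apply: le_trans (escape_iter r_ge0 p_ge0 pI couple_potential_le couple_potential_lt
  V_bound p1 compatible_pair_move compatible_pair_cross compatible_pair0).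
rewrite [leRHS]big_mkcond; apply: le_trans (ler_norm_sum _ _ _) _.
apply: ler_sum => s _; rewrite -mulrBr normrM (ger0_norm (p_ge0 s)).
(* Outside [compatible_pair L1] the two indicators differ by at most 1; inside, the defects next to
   the blockage agree and the difference is 0. *)
case: ifPn => [_ | /negPn /asboolP h].
  rewrite ler_piMr //; do 2!case: (_ && _);
    by rewrite ?subrr ?subr0 ?sub0r ?normrN ?normr0 ?normr1.
by rewrite !(compatible_defect0 L1_gt0 L12 (leqnn _) (h _)) subrr normr0 mulr0.
Qed.

End Coupling.

Theorem theorem1 (R : realType) (L2 : nat) (hL2 : (1 <= L2)%N)
    (L1 : nat) (hL1 : (1 <= L1)%N) (hL12 : (L1 <= L2)%N) :
  (fun r : R => current L2 r : R^o) =
    (fun r : R => current L1 r : R^o) +O_ (0^'+) (fun r : R => r ^+ (L1 + 2) : R^o).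
Proof.
apply/eqaddOP/bigO_exP.
set K : R := (\max_(s : config L2 * config L1) couple_potential s)%:R ^+ L1.+1.
(* The summand 1 ensures that the constant is positive. *)
exists (K + 1); first by rewrite ltr_wpDl // exprn_ge0.
near=> r.
have r_gt0 : 0 < r by near: r; apply: nbhs_right_gt.
have rn_ge0 : 0 <= r ^+ (L1 + 2) by rewrite exprn_ge0 // ltW.
apply: le_trans (current_le hL1 hL12 r_gt0) _.
by rewrite [`|r ^+ _|]ger0_norm // mulrDl lerDl mul1r.
Unshelve. all: by end_near.
Qed.
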